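(* Let $a,b,\alpha\in\mathbb{R}$ and $l>0$, and let $$P(x,y)=y\{(x-a)^2+(y-b)^2-l^2\}-l\{(x-a)\sin\alpha-(y-b)\cos\alpha\}(x^2+y^2-1)\in\mathbb{R}[x,y],$$ so that $P(x,y)=0$ is the equation of the edge of the angular Voronoi diagram of the line segment $s_1$ with endpoints $(\pm1,0)$ and the line segment $s_2$ of length $2l$, midpoint $(a,b)$ and direction angle $\alpha$. Then $P$ has total degree exactly two and is irreducible in $\mathbb{R}[x,y]$ if and only if $P(x,y)=0$ is the equation of an orthogonal hyperbola.
   Context: For a line segment $s$ and a point $p$ in the plane, the visual angle $\theta_p(s)\in[0,\pi]$ is the angle formed by the two rays emanating from $p$ through the two endpoints of $s$. For a finite set of line segments $s_1,\dots,s_n$, the angular Voronoi region of $s_i$ is the set of points $p\in\mathbb{R}^2$ with $\theta_p(s_i)<\theta_p(s_j)$ for all $j\neq i$, and the edge of $s_i,s_j$ is the set of $p$ with $\theta_p(s_i)=\theta_p(s_j)<\theta_p(s_k)$ for all $k\neq i,j$. Convention: coordinates are chosen so that $s_1$ has endpoints $(1,0)$ and $(-1,0)$ (any pair of segments can be brought to this form by a similarity), and $s_2$ has length $2l$, midpoint $(a,b)$ and makes angle $\alpha$ with the $x$-axis. The ''equation of the edge'' is then $P(x,y)=0$ with $P$ as in the claim. (The angles $\alpha$ and $\alpha+\pi$ describe the same segment but give different polynomials; the claim concerns $P$ for every real $\alpha$.) ''$P(x,y)=0$ is the equation of an orthogonal hyperbola'' means that $P$ is a polynomial of degree two defining a non-degenerate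 hyperbola whose two asymptotes are perpendicular (a rectangular hyperbola). *)

(* Defs.v *)
From HB Require Import structures.
From mathcomp Require Import all_boot all_order all_algebra.
From mathcomp Require Import all_classical all_reals all_analysis.
(* The notations of mpoly clash with those of MathComp-Analysis. *)
From mathcomp Require Import -(notations) mpoly.

Set Implicit Arguments.
Unset Strict Implicit.
Unset Printing Implicit Defensive.

Import Order.TTheory GRing.Theory Num.Theory.
Import numFieldNormedType.Exports.

Local Open Scope classical_set_scope.
Local Open Scope ring_scope.

Definition irreducible_elt (D : idomainType) (p : D) : Prop :=
  [/\ p != 0, p \isn't a GRing.unit &
      forall q r : D, p = q * r -> q \is a GRing.unit \/ r \is a GRing.unit].

Section Plane.
Variable R : realType.
Implicit Types (p q c d : R * R) (L H : set (R * R)).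

Definition poly2 := mpoly.mpoly 2 R.

Definition cst2 (k : R) : poly2 := mpoly.mpolyC 2 k.
Definition varX : poly2 := mpoly.mpolyX R (mpoly.mnm1 (ord0 : 'I_2)).
Definition varY : poly2 := mpoly.mpolyX R (mpoly.mnm1 (ord_max : 'I_2)).

(* [msize] is one more than the total degree, and 0 for the zero polynomial. *)
Definition has_total_degree (P : poly2) (n : nat) : Prop :=
  mpoly.msize P = n.+1.

Definition eval2 (P : poly2) p : R :=
  mpoly.meval (fun i : 'I_2 => if i == ord0 then p.1 else p.2) P.

Definition zero_locus (P : poly2) : set (R * R) := [set p | eval2 P p = 0].

Definition edge_poly (a b alpha l : R) : poly2 :=
  varY * ((varX - cst2 a) ^+ 2 + (varY - cst2 b) ^+ 2 - cst2 (l ^+ 2))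
  - cst2 l * ((varX - cst2 a) * cst2 (sin alpha)
              - (varY - cst2 b) * cst2 (cos alpha))
    * (varX ^+ 2 + varY ^+ 2 - 1).

Definition dot2 p q : R := p.1 * q.1 + p.2 * q.2.

(* The library norm on [R * R] is the sup norm, hence an explicit one here. *)
Definition euclid_norm p : R := Num.sqrt (p.1 ^+ 2 + p.2 ^+ 2).

Definition dist_to_set p L : R := inf [set euclid_norm (p - q) | q in L].

Definition line c d : set (R * R) :=
  [set (c.1 + t * d.1, c.2 + t * d.2) | t in [set: R]].

Definition perpendicular L1 L2 : Prop :=
  exists c1 d1 c2 d2 : R * R,
    [/\ d1 != 0, d2 != 0, L1 = line c1 d1, L2 = line c2 d2 & dot2 d1 d2 = 0].

(* The image of x^2/A^2 - y^2/B^2 = 1 under the direct isometry that takes the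
   origin to c and the positive x-axis to the direction of angle phi. *)
Definition hyperbola_at c (phi A B : R) : set (R * R) :=
  [set p | let u := dot2 (p - c) (cos phi, sin phi) in
           let v := dot2 (p - c) (- sin phi, cos phi) in
           u ^+ 2 / A ^+ 2 - v ^+ 2 / B ^+ 2 = 1].

Definition hyperbola H : Prop :=
  exists c (phi A B : R), [/\ 0 < A, 0 < B & H = hyperbola_at c phi A B].

(* A line is an asymptote of a curve if its distance to a point going to
   infinity along the curve tends to 0. *)
Definition asymptote H L : Prop :=
  (exists c d, d != 0 /\ L = line c d) /\
  exists g : R -> R * R,
    [/\ continuous g, forall t, H (g t),
        euclid_norm (g t) @[t --> +oo] --> +oo &
        dist_to_set (g t) L @[t --> +oo] --> 0].

Definition orthogonal_hyperbola H : Prop :=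
  hyperbola H /\
  exists L1 L2, (forall L, asymptote H L <-> L = L1 \/ L = L2) /\
                perpendicular L1 L2.

Definition orthogonal_hyperbola_equation (P : poly2) : Prop :=
  has_total_degree P 2 /\ orthogonal_hyperbola (zero_locus P).

End Plane.

(* Main.v *)
(* The cubic part of P is (x^2 + y^2)((1 + l cos alpha) y - l sin alpha x), so
   degree two forces l = 1, sin alpha = 0 and cos alpha = -1, and then
     P = b x^2 - 2 a x y - b y^2 + (a^2 + b^2) y - b,   (a, b) <> (0, 0).
   The quadratic part has trace zero and the centre is (a/2, b/2), where P takes
   the value k = b ((a^2 + b^2)/4 - 1). If k = 0, P is a product of two affine
   forms and its zero locus contains a line; if k <> 0, the determinant of the
   conic does not vanish, so P is irreducible, and in coordinates rotated by half
   the argument of a vector proportional to (b, -a), P = 0 reads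
   u^2 - v^2 = const. *)
Require Import Defs.
From mathcomp Require Import all_boot all_order all_algebra.
From mathcomp Require Import all_classical all_reals all_analysis.
From mathcomp Require Import -(notations) mpoly.
From mathcomp Require Import ring lra zify.
Import Order.TTheory GRing.Theory Num.Theory.
Import numFieldNormedType.Exports.
Local Open Scope ring_scope.

(** * Polynomials in two variables: units and evaluation in bounded degree *)

Lemma unitr_msize (R : realType) (p : poly2 R) :
  p \is a GRing.unit <-> msize p = 1%N.
Proof.
split.
  by case/andP => /eqP pE; rewrite unitfE => c0; rewrite pE msizeC c0.
move=> /eqP /msize_poly1P [c c0 ->].
apply/andP; rewrite mcoeffC eqxx mulr1; split => //.
by rewrite unitfE.
Qed.

(** An induction principle for reading off normal forms: the evaluation is a sum of monomials, and
    [msize p <= n] means that each has degree less than [n]. *)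
Lemma eval2_closed (R : realType) (n : nat) (K : (R * R -> R) -> Prop) :
  K 0 -> (forall f g, K f -> K g -> K (f + g)) ->
  (forall k i j, (i + j < n)%N -> K (fun z => k * (z.1 ^+ i * z.2 ^+ j))) ->
  forall p : poly2 R, (msize p <= n)%N -> K (eval2 p).
Proof.
move=> K0 KD Kmon p szp.
have -> : eval2 p = \sum_(m <- msupp p)
    (fun z : R * R => mcoeff m p * (z.1 ^+ m ord0 * z.2 ^+ m ord_max)).
  apply/funext => -[x y]; rewrite /eval2 mevalE fct_sumE; apply: eq_bigr => m _.
  rewrite !big_ord_recl big_ord0 mulr1.
  by congr (_ * (_ * _ ^+ m _)); apply/val_inj.
rewrite big_seq; apply: (big_ind K) => // m /msize_mdeg_lt /leq_trans.
move=> /(_ _ szp); rewrite mdegE !big_ord_recl big_ord0 addn0.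
have -> : lift ord0 ord0 = ord_max :> 'I_2 by apply/val_inj.
exact: Kmon.
Qed.

Lemma eval2_affine (R : realType) (p : poly2 R) : (msize p <= 2)%N ->
  exists k0 k1 k2 : R, forall x y, eval2 p (x, y) = k0 + k1 * x + k2 * y.
Proof.
apply: (@eval2_closed R 2 (fun f => exists k0 k1 k2 : R, forall x y,
  f (x, y) = k0 + k1 * x + k2 * y)).
- by exists 0, 0, 0 => x y; rewrite !mul0r !addr0.
- move=> f g [a0 [a1 [a2 fE]]] [b0 [b1 [b2 gE]]].
  exists (a0 + b0), (a1 + b1), (a2 + b2) => x y.
  by transitivity (f (x, y) + g (x, y)) => //; rewrite fE gE; ring.
move=> k [|[|i]] [|[|j]] //= _.
- by exists k, 0, 0 => x y /=; ring.
- by exists 0, 0, k => x y /=; ring.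
- by exists 0, k, 0 => x y /=; ring.
Qed.

Lemma eval2_quadratic (R : realType) (p : poly2 R) : (msize p <= 3)%N ->
  exists k0 k1 k2 k3 k4 k5 : R, forall x y, eval2 p (x, y) =
    k0 + k1 * x + k2 * y + k3 * x ^+ 2 + k4 * x * y + k5 * y ^+ 2.
Proof.
apply: (@eval2_closed R 3 (fun f => exists k0 k1 k2 k3 k4 k5 : R, forall x y,
  f (x, y) = k0 + k1 * x + k2 * y + k3 * x ^+ 2 + k4 * x * y + k5 * y ^+ 2)).
- by exists 0, 0, 0, 0, 0, 0 => x y; rewrite !mul0r !addr0.
- move=> f g [a0 [a1 [a2 [a3 [a4 [a5 fE]]]]]] [b0 [b1 [b2 [b3 [b4 [b5 gE]]]]]].
  exists (a0 + b0), (a1 + b1), (a2 + b2), (a3 + b3), (a4 + b4), (a5 + b5) => x y.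
  by transitivity (f (x, y) + g (x, y)) => //; rewrite fE gE; ring.
move=> k [|[|[|i]]] [|[|[|j]]] //= _.
- by exists k, 0, 0, 0, 0, 0 => x y /=; ring.
- by exists 0, 0, k, 0, 0, 0 => x y /=; ring.
- by exists 0, 0, 0, 0, 0, k => x y /=; ring.
- by exists 0, k, 0, 0, 0, 0 => x y /=; ring.
- by exists 0, 0, 0, 0, k, 0 => x y /=; ring.
- by exists 0, 0, 0, k, 0, 0 => x y /=; ring.
Qed.

Lemma eval2D (R : realType) (p q : poly2 R) z : eval2 (p + q) z = eval2 p z + eval2 q z.
Proof. exact: mevalD. Qed.
Lemma eval2N (R : realType) (p : poly2 R) z : eval2 (- p) z = - eval2 p z.
Proof. exact: mevalN. Qed.
Lemma eval2M (R : realType) (p q : poly2 R) z : eval2 (p * q) z = eval2 p z * eval2 q z.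
Proof. exact: mevalM. Qed.
Lemma eval2X (R : realType) (z : R * R) : eval2 (varX R) z = z.1.
Proof. by rewrite /eval2 /varX mevalXU. Qed.
Lemma eval2Y (R : realType) (z : R * R) : eval2 (varY R) z = z.2.
Proof. by rewrite /eval2 /varY mevalXU. Qed.
Lemma eval2C (R : realType) (c : R) z : eval2 (cst2 c) z = c.
Proof. exact: mevalC. Qed.
Lemma eval21 (R : realType) (z : R * R) : eval2 1 z = 1.
Proof. exact: meval1. Qed.
Definition eval2E := (eval2D, eval2N, eval2M, eval2X, eval2Y, eval2C, eval21).

(** * Values of the edge polynomial and consequences of degree two *)

Lemma eval2_edge_poly (R : realType) (a b alpha l x y : R) :
  eval2 (edge_poly a b alpha l) (x, y) =
  y * ((x - a) ^+ 2 + (y - b) ^+ 2 - l ^+ 2)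
  - l * ((x - a) * sin alpha - (y - b) * cos alpha) * (x ^+ 2 + y ^+ 2 - 1).
Proof. by rewrite /edge_poly !expr2 !eval2E /=; ring. Qed.

Lemma edge_poly_degree2 (R : realType) (a b alpha l : R) : 0 < l ->
  has_total_degree (edge_poly a b alpha l) 2 ->
  [/\ l = 1, sin alpha = 0, cos alpha = -1 & (a != 0) || (b != 0)].
Proof.
move=> l0 sz.
have [|k0 [k1 [k2 [k3 [k4 [k5 pE]]]]]] := @eval2_quadratic _ (edge_poly a b alpha l).
  by rewrite sz.
have pE' x y := etrans (esym (eval2_edge_poly _ a b alpha l x y)) (pE x y).
(* On the x-axis the cubic coefficient is [- l * sin alpha]; it vanishes because the third
   difference of a quadratic is zero. *)
have ls : l * sin alpha = 0.
  have := pE' 0 0; have := pE' 1 0; have := pE' 2 0; have := pE' 3 0.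
  move=> e3 e2 e1 e0.
  lra.
(* Likewise on the y-axis, where the cubic coefficient is [1 + l * cos alpha]. *)
have lc : l * cos alpha = -1.
  have := pE' 0 0; have := pE' 0 1; have := pE' 0 2; have := pE' 0 3.
  move=> e3 e2 e1 e0.
  lra.
have s0 : sin alpha = 0.
  by apply/eqP; move/eqP: ls; rewrite mulf_eq0 gt_eqF.
have := cos2Dsin2 alpha; rewrite s0 expr0n addr0 => c1.
have l1 : l = 1 by nra.
move: lc; rewrite l1 mul1r => lc; split => //.
(* For [a = b = 0] everything cancels, and the zero polynomial has [msize] 0 instead of 3. *)
apply/negP => /negP; rewrite negb_or !negbK => /andP[/eqP a0 /eqP b0].
move: sz; rewrite /has_total_degree.
suff -> : edge_poly a b alpha l = 0 by rewrite msize0.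
rewrite /edge_poly a0 b0 s0 lc l1 expr1n /cst2 !mpolyC0 mpolyCN mpolyC1.
ring.
Qed.

(* The polynomial in the [c]'s is 4 times the determinant of the symmetric
   matrix of the conic. *)
Lemma affine_product_det (R : realType) (k0 k1 k2 m0 m1 m2 c0 c1 c2 c3 c4 c5 : R) :
  (forall x y, c0 + c1 * x + c2 * y + c3 * x ^+ 2 + c4 * x * y + c5 * y ^+ 2 =
     (k0 + k1 * x + k2 * y) * (m0 + m1 * x + m2 * y)) ->
  4 * c0 * c3 * c5 + c1 * c2 * c4 - c3 * c2 ^+ 2 - c5 * c1 ^+ 2 - c0 * c4 ^+ 2 = 0.
Proof.
move=> e.
have e0 : c0 = k0 * m0 by have := e 0 0; lra.
have e1 : c1 = k0 * m1 + k1 * m0 by have := e 1 0; have := e (-1) 0; lra.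
have e2 : c2 = k0 * m2 + k2 * m0 by have := e 0 1; have := e 0 (-1); lra.
have e3 : c3 = k1 * m1 by have := e 1 0; have := e (-1) 0; lra.
have e5 : c5 = k2 * m2 by have := e 0 1; have := e 0 (-1); lra.
have e4 : c4 = k1 * m2 + k2 * m1 by have := e 1 1; lra.
by rewrite e0 e1 e2 e3 e4 e5; ring.
Qed.

(** * Irreducibility of the conic *)

Lemma eval2_edge_conic (R : realType) (a b alpha x y : R) :
  sin alpha = 0 -> cos alpha = -1 ->
  eval2 (edge_poly a b alpha 1) (x, y) =
  b * x ^+ 2 - 2 * a * x * y - b * y ^+ 2 + (a ^+ 2 + b ^+ 2) * y - b.
Proof. by move=> s0 c1; rewrite eval2_edge_poly s0 c1; ring. Qed.

(** The degrees of two nonunit factors add up to two, so both factors are affine, and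
    [affine_product_det] makes the determinant of the conic vanish. *)
Lemma irreducible_of_nondegenerate (R : realType) (a b alpha : R) :
  sin alpha = 0 -> cos alpha = -1 ->
  has_total_degree (edge_poly a b alpha 1) 2 ->
  b * ((a ^+ 2 + b ^+ 2) / 4 - 1) != 0 ->
  irreducible_elt (edge_poly a b alpha 1).
Proof.
set P := edge_poly _ _ _ _ => s0 c1 sz k0.
have P0 : P != 0 by rewrite -msize_poly_eq0 sz.
split => //; first by apply/negP => /unitr_msize; rewrite sz.
move=> q r PE.
have q0 : q != 0 by apply: contraNneq P0 => q0; rewrite PE q0 mul0r.
have r0 : r != 0 by apply: contraNneq P0 => r0; rewrite PE r0 mulr0.
have : msize P = (msize q + msize r).-1 by rewrite PE msizeM.
have [q1 _|q1] := eqVneq (msize q) 1%N; first by left; apply/unitr_msize.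
have [r1 _|r1] := eqVneq (msize r) 1%N; first by right; apply/unitr_msize.
rewrite sz => szqr.
have qn : msize q != 0%N by rewrite msize_poly_eq0.
have rn : msize r != 0%N by rewrite msize_poly_eq0.
have /andP[szq szr] : (msize q <= 2)%N && (msize r <= 2)%N.
  move: szqr q1 r1 qn rn.
  by case: (msize q) => [|[|[|n]]] //; case: (msize r) => [|[|[|m]]] //=; lia.
have [q0' [q1' [q2' qE]]] := @eval2_affine _ q szq.
have [r0' [r1' [r2' rE]]] := @eval2_affine _ r szr.
exfalso; have det0 : 4 * (- b) * b * (- b) + 0 * (a ^+ 2 + b ^+ 2) * (- (2 * a))
    - b * (a ^+ 2 + b ^+ 2) ^+ 2 - (- b) * 0 ^+ 2 - (- b) * (- (2 * a)) ^+ 2 = 0.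
  apply: (@affine_product_det _ q0' q1' q2' r0' r1' r2') => x y.
  by rewrite -qE -rE -eval2M -PE eval2_edge_conic //; ring.
(* The left side of [det0] is [-4 (a^2 + b^2)] times the constant in [k0]. *)
have ab : (a ^+ 2 + b ^+ 2) * (b * ((a ^+ 2 + b ^+ 2) / 4 - 1)) = 0.
  by lra.
move/eqP: ab; rewrite mulf_eq0 (negPf k0) orbF paddr_eq0 ?sqr_ge0 //.
rewrite !sqrf_eq0 => /andP[_ /eqP b0].
by move: k0; rewrite b0 mul0r eqxx.
Qed.

(** The hypotheses say [a + i b = r (u + i v)^2]. If the constant vanishes, then in coordinates
    centred at [(a/2, b/2)] the polynomial is [b X^2 - 2 a X Y - b Y^2], which splits as
    [-2 r (u X + v Y) (- v X + u Y)]. *)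
Lemma nondegenerate_of_irreducible (R : realType) (a b alpha r u v : R) :
  sin alpha = 0 -> cos alpha = -1 ->
  a = r * (u ^+ 2 - v ^+ 2) -> b = 2 * r * u * v -> r != 0 -> u ^+ 2 + v ^+ 2 = 1 ->
  irreducible_elt (edge_poly a b alpha 1) ->
  b * ((a ^+ 2 + b ^+ 2) / 4 - 1) != 0.
Proof.
move=> s0 c1 ae be r0 uv [_ _ irr]; apply/eqP => k0.
(* Writing [a] and [b] as sums of their halves leaves only ring operations once they are moved into
   [poly2]. *)
have [p ap] : exists p, a = p + p by exists (a / 2); field.
have [q bq] : exists q, b = q + q by exists (b / 2); field.
pose X := varX R - cst2 p; pose Y := varY R - cst2 q.
have nonunit (s t : R) : s != 0 \/ t != 0 ->
    (cst2 s * X + cst2 t * Y) \isn't a GRing.unit.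
  (* A unit is a constant, so its values at three noncollinear points agree; this gives
     [s = t = 0]. *)
  move=> st; apply/negP => /unitr_msize /eqP /msize_poly1P [c _ pE].
  have pE' z := f_equal (fun p => eval2 p z) pE.
  have := pE' (0, 0); have := pE' (1, 0); have := pE' (0, 1).
  rewrite /X /Y !eval2E /= => h1 h2 h3.
  by case: st => /eqP; apply; clear -h1 h2 h3; lra.
have CD (s t : R) : cst2 (s + t) = cst2 s + cst2 t by rewrite /cst2 mpolyCD.
have CM (s t : R) : cst2 (s * t) = cst2 s * cst2 t by rewrite /cst2 mpolyCM.
have CN (s : R) : cst2 (- s) = - cst2 s by rewrite /cst2 mpolyCN.
have C1 : cst2 1 = 1 :> poly2 R by rewrite /cst2 mpolyC1.
have C0 : cst2 0 = 0 :> poly2 R by rewrite /cst2 mpolyC0.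
have k0' : cst2 q * (cst2 p * cst2 p + cst2 q * cst2 q - 1) = 0.
  rewrite -C1 -C0; transitivity (cst2 (q * (p * p + q * q - 1))).
    by rewrite CM !CD CN !CM.
  by congr cst2; move: k0; rewrite ap bq => k0; lra.
have exx : cst2 (- 2 * r * u) * cst2 (- v) = cst2 b.
  by rewrite -CM be; congr cst2; ring.
have eyy : cst2 (- 2 * r * v) * cst2 u = - cst2 b.
  by rewrite -CM -CN be; congr cst2; ring.
have exy : cst2 (- 2 * r * u) * cst2 u + cst2 (- 2 * r * v) * cst2 (- v) =
    - 2 * cst2 a.
  transitivity (- (cst2 a + cst2 a)); last by ring.
  transitivity (cst2 (- 2 * r * u * u + (- 2 * r * v) * (- v))).
    by rewrite CD (CM (- 2 * r * u)) (CM (- 2 * r * v)).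
  by rewrite -CD -CN ae; congr cst2; ring.
have PE : edge_poly a b alpha 1 =
    (cst2 (- 2 * r * u) * X + cst2 (- 2 * r * v) * Y) *
    (cst2 (- v) * X + cst2 u * Y).
  transitivity (cst2 b * X ^+ 2 + (- 2 * cst2 a) * X * Y - cst2 b * Y ^+ 2
    + 2 * (cst2 q * (cst2 p * cst2 p + cst2 q * cst2 q - 1))).
    rewrite /edge_poly s0 c1 expr1n CN C1 C0 /X /Y ap bq !CD; ring.
  rewrite k0' mulr0 addr0 -[- (_ * Y ^+ 2)]mulNr -eyy -exy -exx; ring.
have nz : u != 0 \/ v != 0.
  have [u0|] := eqVneq u 0; last by left.
  by right; apply/eqP => v0; move: uv; rewrite u0 v0; lra.
have [] := irr _ _ PE; apply/negP; apply: nonunit.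
  by case: nz => nz; [left | right]; rewrite !mulf_neq0 // oppr_eq0 pnatr_eq0.
by case: nz => nz; [right | left] => //; rewrite oppr_eq0.
Qed.

(** * Lines in the plane and their equations *)

Section Geometry.
Variable R : realType.
Implicit Types (c d e p q : R * R) (m : R).

Definition perp d : R * R := (- d.2, d.1).

(** For [e != 0], the equation in coordinates along two perpendicular axes through [c], which turn
    out to be the asymptotes; [m = 0] gives the two axes themselves. *)
Definition rect_hyperbola c e m : set (R * R) :=
  [set p | dot2 (p - c) e * dot2 (p - c) (perp e) = m]%classic.

Lemma dot2_gt0 d : d != 0 -> 0 < dot2 d d.
Proof.
case: d => x y; rewrite /dot2 /= -!expr2 => d0.
rewrite lt0r addr_ge0 ?sqr_ge0 // andbT paddr_eq0 ?sqr_ge0 // !sqrf_eq0.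
by apply: contra d0 => /andP[/eqP -> /eqP ->].
Qed.

Lemma perp_eq0 d : (perp d == 0) = (d == 0).
Proof.
case: d => x y; rewrite /perp /= -!pair_eqE /= /pair_eq /= oppr_eq0.
by rewrite andbC.
Qed.

(** This exchanges the two axes; the sign comes from [perp (perp e) = - e]. *)
Lemma perp_rect_hyperbola c e m :
  rect_hyperbola c (perp e) (- m) = rect_hyperbola c e m.
Proof.
rewrite /rect_hyperbola /dot2 /perp; apply/seteqP; split => p /=; lra.
Qed.

Lemma euclid_norm_ge0 p : 0 <= euclid_norm p.
Proof. exact: sqrtr_ge0. Qed.

Lemma euclid_norm_sqr p : euclid_norm p ^+ 2 = dot2 p p.
Proof. by rewrite sqr_sqrtr ?addr_ge0 ?sqr_ge0 // /dot2 !expr2. Qed.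

Lemma dot2_le p q : dot2 p q <= euclid_norm p * euclid_norm q.
Proof.
apply: le_trans (ler_norm _) _.
rewrite -[leRHS]ger0_norm ?mulr_ge0 ?euclid_norm_ge0 // -ler_sqr ?nnegrE //.
rewrite !real_normK ?num_real // exprMn !euclid_norm_sqr /dot2.
have := sqr_ge0 (p.1 * q.2 - p.2 * q.1); lra.
Qed.

Lemma lineE c d : d != 0 ->
  line c d = [set p | dot2 (p - c) (perp d) = 0]%classic.
Proof.
move=> /dot2_gt0 d0; apply/seteqP; split => [p [t _ <-]|p].
  by rewrite /dot2 /perp /=; ring.
case: p c d d0 => [x y] [c1 c2] [d1 d2]; rewrite /dot2 /perp /= => d0 h.
(* The parameter of the orthogonal projection onto the line. *)
exists (((x - c1) * d1 + (y - c2) * d2) / (d1 * d1 + d2 * d2)) => //=.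
have dn0 := lt0r_neq0 d0.
congr (_, _).
  transitivity (x + d2 * ((x - c1) * - d2 + (y - c2) * d1) / (d1 * d1 + d2 * d2)).
    by field.
  by rewrite h mulr0 mul0r addr0.
transitivity (y - d1 * ((x - c1) * - d2 + (y - c2) * d1) / (d1 * d1 + d2 * d2)).
  by field.
by rewrite h mulr0 mul0r subr0.
Qed.

Lemma eq_line c d c' d' : d != 0 -> d' != 0 ->
  dot2 d' (perp d) = 0 -> dot2 (c' - c) (perp d) = 0 -> line c' d' = line c d.
Proof.
move=> d0 d0' dd' cd; rewrite !lineE //.
move: (dot2_gt0 _ d0) (dot2_gt0 _ d0') dd' cd.
case: c d c' d' {d0 d0'} => [c1 c2] [d1 d2] [c1' c2'] [d1' d2'].
rewrite /dot2 /perp /= => d0 d0' dd' cd; apply/seteqP; split => -[x y] /= h.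
  have : (d1' * d1' + d2' * d2') * ((x - c1) * - d2 + (y - c2) * d1) = 0.
    transitivity (((x - c1') * d1' + (y - c2') * d2') * (d1' * - d2 + d2' * d1)
      + ((x - c1') * - d2' + (y - c2') * d1') * (d1' * d1 + d2' * d2)
      + (d1' * d1' + d2' * d2') * ((c1' - c1) * - d2 + (c2' - c2) * d1)); first by ring.
    by rewrite h dd' cd !(mulr0, mul0r) !addr0.
  by move/eqP; rewrite mulf_eq0 gt_eqF //= => /eqP.
have : (d1 * d1 + d2 * d2) * ((x - c1') * - d2' + (y - c2') * d1') = 0.
  transitivity (- ((x - c1') * d1 + (y - c2') * d2) * (d1' * - d2 + d2' * d1)
    + ((x - c1) * - d2 + (y - c2) * d1 - ((c1' - c1) * - d2 + (c2' - c2) * d1))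
      * (d1' * d1 + d2' * d2)); first by ring.
  by rewrite h dd' cd subr0 !(mulr0, mul0r) addr0.
by move/eqP; rewrite mulf_eq0 gt_eqF //= => /eqP.
Qed.

(** * Distance to a line, and affine forms that are small far out on a hyperbola *)

Lemma dist_line_le c d p q :
  line c d q -> dist_to_set p (line c d) <= euclid_norm (p - q).
Proof.
move=> Lq; apply: ge_inf; last by exists q.
by exists 0 => _ [z _ <-]; exact: euclid_norm_ge0.
Qed.

Lemma dist_to_set_ge0 p (L : set (R * R)) : 0 <= dist_to_set p L.
Proof.
have [->|/set0P L0] := eqVneq L set0.
  by rewrite /dist_to_set image_set0 inf0.
apply: lb_le_inf; first by case: L0 => q Lq; exists (euclid_norm (p - q)), q.
by move=> _ [z _ <-]; exact: euclid_norm_ge0.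
Qed.

(** The form [dot2 (p - c) (perp d)] is the length of [d] times the signed distance from [p] to the
    line. It is unchanged when [c] is replaced by a point [q] of the line with
    [euclid_norm (p - q) < eps], and Cauchy-Schwarz applies. *)
Lemma dist_line_lt c d p eps : d != 0 -> dist_to_set p (line c d) < eps ->
  dot2 (p - c) (perp d) ^+ 2 <= dot2 d d * eps ^+ 2.
Proof.
move=> d0 lt_eps.
have [] := @inf_adherent R [set euclid_norm (p - q) | q in line c d]%classic
  (eps - dist_to_set p (line c d)).
- by rewrite subr_gt0.
- split; first by exists (euclid_norm (p - c)), c => //;
    exists 0; rewrite // !mul0r !addr0; case: (c).
  by exists 0 => _ [z _ <-]; exact: euclid_norm_ge0.
rewrite -/(dist_to_set p (line c d)) addrC subrK => _ [q Lq <-] lt_q.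
rewrite lineE //= in Lq.
have -> : dot2 (p - c) (perp d) = dot2 (p - q) (perp d).
  by move: Lq; rewrite /dot2 /=; lra.
have : dot2 (p - q) (perp d) ^+ 2 <= dot2 d d * dot2 (p - q) (p - q).
  have := sqr_ge0 (dot2 (p - q) d); rewrite /dot2 /perp /=; lra.
move=> /le_trans; apply; apply: ler_wpM2l; first exact: ltW (dot2_gt0 _ d0).
by rewrite -euclid_norm_sqr ler_sqr ?nnegrE ?euclid_norm_ge0 ?ltW //
  (le_lt_trans (euclid_norm_ge0 _) lt_q).
Qed.

(* On [U * V = m] the cross term of [(n1 U + n2 V)^2] is constant, so the form is
   unbounded unless it depends on one coordinate only; the latter then tends to 0. *)
Lemma asymptote_form n1 n2 k m : n1 != 0 \/ n2 != 0 ->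
  (forall M eps : R, 0 < eps -> exists U V, [/\ U * V = m, M < U ^+ 2 + V ^+ 2
     & (n1 * U + n2 * V - k) ^+ 2 <= eps]) ->
  n1 * n2 = 0 /\ k = 0.
Proof.
move=> n0 H.
have n12 : n1 * n2 = 0.
  apply/eqP/negPn/negP => nn.
  have [n1s n2s] : 0 < n1 ^+ 2 /\ 0 < n2 ^+ 2.
    by move: nn; rewrite mulf_eq0 negb_or !exprn_even_gt0 //= => /andP[].
  pose mu := Num.min (n1 ^+ 2) (n2 ^+ 2).
  have mu0 : 0 < mu by rewrite lt_min n1s.
  (* With [w = n1 U + n2 V], [(w - k)^2 <= 1] gives [w^2 <= 2 + 2 k^2], hence
     [mu (U^2 + V^2) <= 2 + 2 k^2 - 2 n1 n2 m]. *)
  have [U [V [UV M_lt le1]]] :=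
    H ((2 + 2 * k ^+ 2 - 2 * (n1 * n2) * m) / mu) 1 ltr01.
  move: M_lt; rewrite ltr_pdivrMr // ltNge => /negP; apply.
  have le_mu1 : mu <= n1 ^+ 2 by rewrite ge_min lexx.
  have le_mu2 : mu <= n2 ^+ 2 by rewrite ge_min lexx orbT.
  have h1 := ler_wpM2l (sqr_ge0 U) le_mu1.
  have h2 := ler_wpM2l (sqr_ge0 V) le_mu2.
  have h3 := sqr_ge0 (n1 * U + n2 * V - 2 * k).
  rewrite -UV; lra.
split=> //.
wlog n1_0 : n1 n2 n0 n12 H / n1 = 0.
  move=> wl; move/eqP: (n12); rewrite mulf_eq0 => /orP[/eqP|/eqP n2_0].
    exact: (wl n1 n2).
  apply: (wl n2 n1) => //; first by case: n0; [right | left].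
    by rewrite mulrC.
  move=> M eps eps0; have [U [V [UV M_lt le_eps]]] := H M eps eps0.
  by exists V, U; split; [rewrite mulrC | rewrite addrC | rewrite [n2 * V + _]addrC].
have n2_0 : n2 != 0 by case: n0 => //; rewrite n1_0 eqxx.
apply/eqP/negPn/negP => k0.
have n2s : 0 < n2 ^+ 2 by rewrite exprn_even_gt0.
have ks : 0 < k ^+ 2 by rewrite exprn_even_gt0.
(* If [n2 V] is within [|k| / 2] of [k], then [dl <= V^2 <= 9 dl], so [U V = m] bounds [U^2] by
   [m^2 / dl]; the point cannot be far out. *)
pose dl := k ^+ 2 / (4 * n2 ^+ 2).
have dl0 : 0 < dl by rewrite divr_gt0 // mulr_gt0.
have n2dl : n2 ^+ 2 * dl = k ^+ 2 / 4 by rewrite /dl; field.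
have [U [V [UV M_lt le_eps]]] :=
  H (m ^+ 2 / dl + 9 * dl) (k ^+ 2 / 4) (divr_gt0 ks (ltr0n _ 4)).
move: le_eps; rewrite n1_0 mul0r add0r => le_eps.
have V_ge : dl <= V ^+ 2.
  rewrite -(ler_pM2l n2s) n2dl.
  have := sqr_ge0 (n2 * V - k / 2); lra.
have V_le : V ^+ 2 <= 9 * dl.
  rewrite -(ler_pM2l n2s) [leRHS]mulrCA n2dl.
  have := sqr_ge0 (n2 * V - 3 * k / 2); lra.
have U_le : U ^+ 2 <= m ^+ 2 / dl.
  by rewrite ler_pdivlMr // -UV exprMn ler_wpM2l ?sqr_ge0.
lra.
Qed.

(** * The asymptotes of a rectangular hyperbola *)

Lemma rect_hyperbola_asymptote c e m : e != 0 ->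
  asymptote (rect_hyperbola c e m) (line c e).
Proof.
move=> e0; split; first by exists c, e.
pose E := dot2 e e; have E0 : 0 < E by apply: dot2_gt0.
have ne0 : 0 < euclid_norm e by rewrite sqrtr_gt0 !expr2.
have EE : E = e.1 * e.1 + e.2 * e.2 by [].
have En0 := lt0r_neq0 E0.
(* The curve whose products with [e] and [perp e], measured from [c], are [exp t] and
   [m exp (-t)]. *)
pose g t := (c.1 + e.1 / E * expR t + - (m * e.2 / E) * expR (- t),
             c.2 + e.2 / E * expR t + m * e.1 / E * expR (- t)).
have ge t : dot2 (g t - c) e = expR t.
  transitivity ((e.1 * e.1 + e.2 * e.2) / E * expR t).
    by rewrite /dot2 /=; field.
  by rewrite -EE divff // mul1r.
have gp t : dot2 (g t - c) (perp e) = m * expR (- t).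
  transitivity ((e.1 * e.1 + e.2 * e.2) / E * (m * expR (- t))).
    by rewrite /dot2 /perp /=; field.
  by rewrite -EE divff // mul1r.
exists g; split.
- have cont (x y z : R) : continuous (fun t => x + y * expR t + z * expR (- t)).
    move=> t; apply: cvgD.
      apply: cvgD; first exact: cvg_cst.
      by apply: cvgM; [exact: cvg_cst | exact: continuous_expR].
    apply: cvgM; first exact: cvg_cst.
    by apply: continuous_comp; [exact: opp_continuous | exact: continuous_expR].
  by move=> t; exact: (cvg_pair (cont _ _ _ t) (cont _ _ _ t)).
- by move=> t; rewrite /rect_hyperbola /= ge gp mulrCA expRxMexpNx_1 mulr1.
- apply/cvgryPge => A; near=> t.
  rewrite -(ler_pM2r ne0); apply: le_trans (dot2_le _ _).
  have -> : dot2 (g t) e = dot2 (g t - c) e + dot2 c e by rewrite /dot2 /=; ring.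
  rewrite ge -lerBlDr; apply: le_trans (expR_ge1Dx _).
  by apply: ler_wpDl => //; near: t; exact: nbhs_pinfty_ge.
apply: (@squeeze_cvgr _ _ _ _ (fun=> 0) _ _ _ _ (cvg_cst 0)
  (_ : (`|m| / euclid_norm e * expR (- t)) @[t --> +oo] --> 0)%classic).
- near=> t; rewrite dist_to_set_ge0 /=.
  (* The orthogonal projection of [g t] onto the line, at distance [|m| exp (-t)] divided by the
     norm of [e]. *)
  pose q := (c.1 + expR t / E * e.1, c.2 + expR t / E * e.2).
  have Lq : line c e q by exists (expR t / E).
  apply: le_trans (dist_line_le _ _ _ _ Lq) _.
  rewrite -ler_sqr ?nnegrE ?mulr_ge0 ?invr_ge0 ?expR_ge0 ?euclid_norm_ge0 //.
  rewrite euclid_norm_sqr !exprMn exprVn euclid_norm_sqr real_normK ?num_real // -/E.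
  rewrite le_eqVlt; apply/orP; left; apply/eqP.
  transitivity (m ^+ 2 * (e.1 * e.1 + e.2 * e.2) / E ^+ 2 * expR (- t) ^+ 2).
    by rewrite /dot2 /=; field.
  by rewrite -EE; field.
rewrite -[X in (_ --> X)%classic](mulr0 (`|m| / euclid_norm e)).
by apply: cvgM; [exact: cvg_cst | exact: cvgr_expR].
Unshelve. all: by end_near.
Qed.

(** Conversely, let [U], [V] be the products of [p - c] with [e] and [perp e]. The form defining a
    candidate line becomes [n1 U + n2 V - k], and [asymptote_form] makes the line parallel to an
    axis ([n1 n2 = 0]) and pass through [c] ([k = 0]). *)
Lemma rect_hyperbola_asymptotes c e m (L : set (R * R)) : e != 0 ->
  asymptote (rect_hyperbola c e m) L <-> L = line c e \/ L = line c (perp e).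
Proof.
move=> e0; split; last first.
  case=> ->; first exact: rect_hyperbola_asymptote.
  rewrite -perp_rect_hyperbola; apply: rect_hyperbola_asymptote.
  by rewrite perp_eq0.
move=> [[c' [d [d0 ->]]] [g [_ Hg ginf gL]]].
pose E := dot2 e e; have E0 : 0 < E by apply: dot2_gt0.
have [] := @asymptote_form (dot2 e (perp d) / E) (dot2 (perp e) (perp d) / E)
  (dot2 (c' - c) (perp d)) m.
- apply/orP; rewrite -negb_and; apply/negP => /andP[/eqP n1 /eqP n2].
  have : E * dot2 d d = 0.
    transitivity (E ^+ 2 * ((dot2 e (perp d) / E) ^+ 2
      + (dot2 (perp e) (perp d) / E) ^+ 2)); last by rewrite n1 n2; ring.
    transitivity (dot2 e (perp d) ^+ 2 + dot2 (perp e) (perp d) ^+ 2).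
      by rewrite /E /dot2 /perp /=; ring.
    by field; exact: lt0r_neq0.
  by move/eqP; rewrite mulf_eq0 !gt_eqF // dot2_gt0.
- move=> M eps eps0.
  have D0 := dot2_gt0 _ d0.
  (* The threshold comes from [|g|^2 <= 2 |g - c|^2 + 2 |c|^2] and [U^2 + V^2 = E |g - c|^2]. *)
  have ginf' : \forall t \near +oo,
      Num.sqrt (2 * (dot2 c c + `|M| / E)) + 1 <= euclid_norm (g t).
    by move/cvgryPge : ginf; apply.
  have gL' : \forall t \near +oo,
      `|dist_to_set (g t) (line c' d)| < Num.sqrt (eps / dot2 d d).
    by apply: (cvgr0_norm_lt _ gL); rewrite sqrtr_gt0 divr_gt0.
  have [t [gt1 gt2]] := filter_ex (filterI ginf' gL').
  exists (dot2 (g t - c) e), (dot2 (g t - c) (perp e)); split.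
  + exact: Hg.
  + have -> : dot2 (g t - c) e ^+ 2 + dot2 (g t - c) (perp e) ^+ 2
        = E * dot2 (g t - c) (g t - c).
      by rewrite /E /dot2 /perp /=; ring.
    apply: le_lt_trans (ler_norm M) _; rewrite mulrC -ltr_pdivrMr //.
    have : 2 * (dot2 c c + `|M| / E) < dot2 (g t) (g t).
      rewrite -[ltRHS]euclid_norm_sqr -[ltLHS]sqr_sqrtr.
        rewrite ltr_sqr ?nnegrE ?sqrtr_ge0 ?euclid_norm_ge0 //.
        by apply: lt_le_trans gt1; rewrite ltrDl.
      by rewrite mulr_ge0 // addr_ge0 ?divr_ge0 ?(ltW E0) // /dot2 -!expr2 addr_ge0 ?sqr_ge0.
    have := sqr_ge0 ((g t).1 - 2 * c.1); have := sqr_ge0 ((g t).2 - 2 * c.2).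
    rewrite /dot2 /=; lra.
  have -> : dot2 e (perp d) / E * dot2 (g t - c) e
      + dot2 (perp e) (perp d) / E * dot2 (g t - c) (perp e)
      - dot2 (c' - c) (perp d) = dot2 (g t - c') (perp d).
    transitivity ((e.1 * e.1 + e.2 * e.2) / E * dot2 (g t - c) (perp d)
      - dot2 (c' - c) (perp d)).
      by rewrite /dot2 /perp /=; field; rewrite lt0r_neq0.
    by rewrite -/(dot2 e e) divff ?lt0r_neq0 // mul1r /dot2 /=; ring.
  have -> : eps = dot2 d d * Num.sqrt (eps / dot2 d d) ^+ 2.
    by rewrite sqr_sqrtr ?divr_ge0 ?ltW //; field; rewrite lt0r_neq0.
  by apply: dist_line_lt => //; apply: le_lt_trans (ler_norm _) gt2.
move=> /eqP; rewrite !mulf_eq0 invr_eq0 (gt_eqF E0) !orbF => n12 k0.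
have k0' : dot2 (c - c') (perp d) = 0 by move: k0; rewrite /dot2 /=; lra.
case/orP: n12 => /eqP n; [left | right]; apply/esym/eq_line => //.
by rewrite perp_eq0.
Qed.

(** * Hyperbolas in standard position and the centred conic *)

(** [u^2 - v^2 = (u - v) (u + v)], and these factors are the products with the given vector and its
    [perp]. *)
Lemma hyperbola_at_rect c (phi A : R) : 0 < A -> hyperbola_at c phi A A =
  rect_hyperbola c (cos phi + sin phi, sin phi - cos phi) (A ^+ 2).
Proof.
move=> A0; have A2 : A ^+ 2 != 0 by rewrite expf_neq0 // gt_eqF.
rewrite /hyperbola_at /rect_hyperbola /dot2 /perp; apply/seteqP; split => p /=.
  move=> h; rewrite -[RHS]mul1r -[X in X * A ^+ 2]h; field.
  by rewrite gt_eqF.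
move=> h; rewrite -mulrBl; apply: (mulIf A2).
by rewrite divfK // mul1r -h; ring.
Qed.

Lemma orthogonal_hyperbola_at c (phi A : R) : 0 < A ->
  orthogonal_hyperbola (hyperbola_at c phi A A).
Proof.
move=> A0; split; first by exists c, phi, A, A.
pose e := (cos phi + sin phi, sin phi - cos phi).
have e0 : e != 0.
  apply/eqP => -[h1 h2]; have := cos2Dsin2 phi.
  have -> : cos phi = 0 by lra.
  have -> : sin phi = 0 by lra.
  by rewrite expr0n addr0 => /eqP; rewrite eq_sym oner_eq0.
exists (line c e), (line c (perp e)); split.
  move=> L; rewrite hyperbola_at_rect //.
  exact: rect_hyperbola_asymptotes.
exists c, e, c, (perp e); split => //; first by rewrite perp_eq0.
by rewrite /dot2 /perp /=; ring.
Qed.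

(** In coordinates scaled by [A] and [B], the values at [t = 0, 1, -1] give [u0^2 - v0^2 = 1],
    [u1^2 = v1^2] and [u0 u1 = v0 v1]. Together they force [u1 = v1 = 0], that is [d = 0]. *)
Lemma line_not_sub_hyperbola (H : set (R * R)) c d : d != 0 -> hyperbola H ->
  ~ (line c d `<=` H)%classic.
Proof.
move=> d0 [c' [phi [A [B [A0 B0 ->]]]]] sub.
have onH t : hyperbola_at c' phi A B (c.1 + t * d.1, c.2 + t * d.2).
  by apply: sub; exists t.
have := onH 0; have := onH 1; have := onH (-1).
rewrite /hyperbola_at /dot2 /= => hm h1 h0.
pose u0 := ((c.1 - c'.1) * cos phi + (c.2 - c'.2) * sin phi) / A.
pose v0 := ((c.1 - c'.1) * - sin phi + (c.2 - c'.2) * cos phi) / B.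
pose u1 := (d.1 * cos phi + d.2 * sin phi) / A.
pose v1 := (d.1 * - sin phi + d.2 * cos phi) / B.
have An0 := lt0r_neq0 A0; have Bn0 := lt0r_neq0 B0.
have e0 : u0 ^+ 2 - v0 ^+ 2 = 1.
  by rewrite -h0 /u0 /v0; field; rewrite An0 Bn0.
have ep : (u0 + u1) ^+ 2 - (v0 + v1) ^+ 2 = 1.
  by rewrite -h1 /u0 /v0 /u1 /v1; field; rewrite An0 Bn0.
have em : (u0 - u1) ^+ 2 - (v0 - v1) ^+ 2 = 1.
  by rewrite -hm /u0 /v0 /u1 /v1; field; rewrite An0 Bn0.
have e1 : u1 ^+ 2 = v1 ^+ 2 by lra.
have e01 : u0 * u1 = v0 * v1 by lra.
have u1_0 : u1 ^+ 2 = 0.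
  transitivity (u1 ^+ 2 * (u0 ^+ 2 - v0 ^+ 2)); first by rewrite e0 mulr1.
  transitivity ((u0 * u1) ^+ 2 - u1 ^+ 2 * v0 ^+ 2); first by ring.
  by rewrite e01 e1; ring.
have := dot2_gt0 _ d0.
have -> : dot2 d d = (A * u1) ^+ 2 + (B * v1) ^+ 2.
  rewrite -[LHS]mul1r -(cos2Dsin2 phi) /u1 /v1 /dot2; field.
  by rewrite An0 Bn0.
by rewrite (exprMn 2 A) (exprMn 2 B) -e1 u1_0 !mulr0 addr0 ltxx.
Qed.

(** [x + i y = r exp (2 i phi)]: the argument is [acos (x / r)], negated when [y < 0], and [phi] is
    half of it. *)
Lemma polar_double_angle (x y : R) : (x != 0) || (y != 0) ->
  exists r phi : R, [/\ 0 < r, x = r * (cos phi ^+ 2 - sin phi ^+ 2)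
    & y = 2 * r * cos phi * sin phi].
Proof.
move=> xy0; pose r := Num.sqrt (x ^+ 2 + y ^+ 2).
have r2 : r ^+ 2 = x ^+ 2 + y ^+ 2 by rewrite sqr_sqrtr ?addr_ge0 ?sqr_ge0.
have r0 : 0 < r.
  rewrite sqrtr_gt0 lt0r addr_ge0 ?sqr_ge0 // andbT paddr_eq0 ?sqr_ge0 //.
  by rewrite !sqrf_eq0 negb_and.
have xr : -1 <= x / r <= 1.
  rewrite -ler_norml normrM normfV (gtr0_norm r0) ler_pdivrMr // mul1r.
  by rewrite -sqrtr_sqr ler_wsqrtr // lerDl sqr_ge0.
have cosE : cos (acos (x / r)) = x / r by rewrite acosK.
have sinE : sin (acos (x / r)) = `|y| / r.
  rewrite sin_acos // (_ : 1 - _ = (y / r) ^+ 2).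
    by rewrite sqrtr_sqr normrM normfV (gtr0_norm r0).
  by rewrite !expr_div_n -(divff (expf_neq0 2 (lt0r_neq0 r0))) r2 -mulrBl addrC addKr.
have [th [xE yE]] : exists th, x = r * cos th /\ y = r * sin th.
  have [y_ge0|y_lt0] := leP 0 y.
    exists (acos (x / r)); rewrite cosE sinE ger0_norm //.
    by split; rewrite mulrC divfK ?gt_eqF.
  exists (- acos (x / r)); rewrite cosN sinN cosE sinE ltr0_norm // mulNr opprK.
  by split; rewrite mulrC divfK ?gt_eqF.
exists r, (th / 2); rewrite xE yE.
have -> : th = th / 2 + th / 2 by field.
rewrite cosD sinD (_ : (th / 2 + th / 2) / 2 = th / 2); last by field.
by split=> //; ring.
Qed.

Lemma conic_hyperbola (a b k : R) : (a != 0) || (b != 0) ->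
  k = b * ((a ^+ 2 + b ^+ 2) / 4 - 1) -> k != 0 ->
  exists c (phi A : R), 0 < A /\ hyperbola_at c phi A A =
    [set p | b * p.1 ^+ 2 - 2 * a * p.1 * p.2 - b * p.2 ^+ 2
      + (a ^+ 2 + b ^+ 2) * p.2 - b = 0]%classic.
Proof.
move=> ab0 kE k0.
(* With this sign [s k < 0], so the equation times [s], [r (u^2 - v^2) + s k = 0], has the standard
   form with [A^2 = |k| / r]. *)
pose s : R := - Num.sg k.
have s2 : s ^+ 2 = 1 by rewrite sqrrN sqr_sg k0.
have sk : s * k < 0 by rewrite mulNr -normrEsg oppr_lt0 normr_gt0.
have s0 : s != 0 by rewrite oppr_eq0 sgr_eq0.
have [|r [phi [r0 bE aE]]] := polar_double_angle (s * b) (- (s * a)).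
  by rewrite oppr_eq0 !mulf_eq0 (negPf s0) orbC.
have A2 : 0 < - (s * k) / r by rewrite divr_gt0 ?oppr_gt0.
exists (a / 2, b / 2), phi, (Num.sqrt (- (s * k) / r)).
split; first by rewrite sqrtr_gt0.
rewrite /hyperbola_at /dot2 sqr_sqrtr ?ltW //.
have key (x y : R) : b * x ^+ 2 - 2 * a * x * y - b * y ^+ 2 + (a ^+ 2 + b ^+ 2) * y - b
  = s * r * (((x - a / 2) * cos phi + (y - b / 2) * sin phi) ^+ 2
     - ((x - a / 2) * - sin phi + (y - b / 2) * cos phi) ^+ 2) + k.
  have cs := cos2Dsin2 phi.
  have bE' : b = s * (r * (cos phi ^+ 2 - sin phi ^+ 2)).
    by rewrite -bE mulrA -expr2 s2 mul1r.
  have aE' : a = - (s * (2 * r * cos phi * sin phi)).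
    by rewrite -aE mulrN opprK mulrA -expr2 s2 mul1r.
  transitivity (b * ((x - a / 2) ^+ 2 - (y - b / 2) ^+ 2)
    - 2 * a * (x - a / 2) * (y - b / 2) + k); first by rewrite kE; field.
  move: (x - a / 2) (y - b / 2) => X Y.
  by rewrite bE' aE'; ring.
have sM : s * r * (- (s * k) / r) + k = 0.
  transitivity (k - s ^+ 2 * k); first by field; rewrite gt_eqF.
  by rewrite s2 mul1r subrr.
have sr0 : s * r != 0 by rewrite mulf_neq0 // gt_eqF.
apply/seteqP; split => -[x y] /=; rewrite key -mulrBl.
  move: (- (s * k) / r) A2 sM => M M0 sM h.
  by rewrite -[X in _ * X + _](divfK (lt0r_neq0 M0)) h mul1r.
rewrite -sM => /addIr /(mulfI sr0) ->.
by rewrite divff ?gt_eqF.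
Qed.

End Geometry.

(** * The equivalence once the degree is two *)

Theorem theorem3 (R : realType) (a b alpha l : R) (hl : 0 < l) :
  (has_total_degree (edge_poly a b alpha l) 2 /\
   irreducible_elt (edge_poly a b alpha l))
  <-> orthogonal_hyperbola_equation (edge_poly a b alpha l).
Proof.
rewrite /orthogonal_hyperbola_equation.
suff eqv : has_total_degree (edge_poly a b alpha l) 2 ->
    (irreducible_elt (edge_poly a b alpha l) <->
     orthogonal_hyperbola (zero_locus (edge_poly a b alpha l))).
  by split=> -[sz h]; split => //; apply/eqv.
move=> sz; have [l1 s0 c1 ab0] := edge_poly_degree2 _ _ _ _ _ hl sz.
rewrite l1 in sz *.
have locE : zero_locus (edge_poly a b alpha 1) =
    [set p | b * p.1 ^+ 2 - 2 * a * p.1 * p.2 - b * p.2 ^+ 2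
      + (a ^+ 2 + b ^+ 2) * p.2 - b = 0]%classic.
  by apply/funext => -[x y]; rewrite /zero_locus /mkset eval2_edge_conic.
have [r [w [r0 aE bE]]] := polar_double_angle _ _ _ ab0.
split=> [irr|[hyp _]].
  have k0 : b * ((a ^+ 2 + b ^+ 2) / 4 - 1) != 0.
    apply: (nondegenerate_of_irreducible _ _ _ _ _ _ _ s0 c1 aE bE _ _ irr).
      by rewrite gt_eqF.
    exact: cos2Dsin2.
  rewrite locE.
  have [c [phi [A [A0 <-]]]] := conic_hyperbola _ _ _ _ ab0 erefl k0.
  exact: orthogonal_hyperbola_at.
apply: irreducible_of_nondegenerate => //; apply/eqP => k0.
have d0 : (cos w, sin w) != 0.
  apply/eqP => -[h1 h2]; have := cos2Dsin2 w; rewrite h1 h2.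
  by rewrite expr0n addr0 => /eqP; rewrite eq_sym oner_eq0.
(* With zero constant term, the line through the centre at half the argument of [(a, b)] lies in the
   zero locus: the quadratic form vanishes in that direction. *)
apply: (line_not_sub_hyperbola _ _ (a / 2, b / 2) _ d0 hyp).
rewrite locE => _ [t _ <-] /=.
transitivity (t ^+ 2 * (b * (cos w ^+ 2 - sin w ^+ 2) - 2 * a * cos w * sin w)
  + b * ((a ^+ 2 + b ^+ 2) / 4 - 1)); first by field.
by rewrite k0 aE bE; ring.
Qed.
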